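(* Let $k\ge 1$ and let $\tau\in\mathfrak S_k(132)$ have canonical decomposition $\tau=(\tau^0,m_0,\tau^1,m_1,\dots,\tau^r,m_r)$, with prefixes $\pi^d$ and suffixes $\sigma^d$. Then the generating functions $\mathfrak E_\tau(x)$ and $\mathfrak O_\tau(x)$ are rational functions of $x$. Moreover, writing $$A_d(x)=\mathfrak E_{\pi^d}(x)-\mathfrak E_{\pi^{d-1}}(x),\qquad B_d(x)=\mathfrak O_{\pi^d}(x)-\mathfrak O_{\pi^{d-1}}(x)\qquad(0\le d\le r),$$ they satisfy $$\mathfrak E_\tau(x)-\mathfrak E_\tau(-x)=x\sum_{d=0}^r\Bigl(A_d(x)\mathfrak E_{\sigma^d}(x)+A_d(-x)\mathfrak E_{\sigma^d}(-x)+B_d(x)\mathfrak O_{\sigma^d}(x)+B_d(-x)\mathfrak O_{\sigma^d}(-x)\Bigr),$$ $$\mathfrak O_\tau(x)-\mathfrak O_\tau(-x)=x\sum_{d=0}^r\Bigl(A_d(x)\mathfrak O_{\sigma^d}(x)+A_d(-x)\mathfrak O_{\sigma^d}(-x)+B_d(x)\mathfrak E_{\sigma^d}(x)+B_d(-x)\mathfrak E_{\sigma^d}(-x)\Bigr),$$ $$\begin{aligned}\mathfrak E_\tau(x)+\mathfrak E_\tau(-x)-2=\frac x2\sum_{d=0}^r\Bigl(&(A_d(x)+A_d(-x))(\mathfrak O_{\sigma^d}(x)-\mathfrak O_{\sigma^d}(-x))+(B_d(x)+B_d(-x))(\mathfrak E_{\sigma^d}(x)-\mathfrak E_{\sigma^d}(-x))\\&+(A_d(x)-A_d(-x))(\mathfrak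 E_{\sigma^d}(x)+\mathfrak E_{\sigma^d}(-x))+(B_d(x)-B_d(-x))(\mathfrak O_{\sigma^d}(x)+\mathfrak O_{\sigma^d}(-x))\Bigr),\end{aligned}$$ $$\begin{aligned}\mathfrak O_\tau(x)+\mathfrak O_\tau(-x)=\frac x2\sum_{d=0}^r\Bigl(&(A_d(x)+A_d(-x))(\mathfrak E_{\sigma^d}(x)-\mathfrak E_{\sigma^d}(-x))+(B_d(x)+B_d(-x))(\mathfrak O_{\sigma^d}(x)-\mathfrak O_{\sigma^d}(-x))\\&+(A_d(x)-A_d(-x))(\mathfrak O_{\sigma^d}(x)+\mathfrak O_{\sigma^d}(-x))+(B_d(x)-B_d(-x))(\mathfrak E_{\sigma^d}(x)+\mathfrak E_{\sigma^d}(-x))\Bigr).\end{aligned}$$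
   Context: $\mathfrak S_n$ is the set of permutations of $\{1,\dots,n\}$ ($\mathfrak S_0$ consists of the empty permutation, which is even). A permutation $\pi$ avoids a pattern $\tau\in\mathfrak S_k$ if no subsequence of $\pi$ of length $k$ is order-isomorphic to $\tau$; $\mathfrak S_k(132)$ is the set of $132$-avoiding permutations in $\mathfrak S_k$. For a pattern $\tau$, $e_\tau(n)$ (resp. $o_\tau(n)$) is the number of even (resp. odd) permutations in $\mathfrak S_n$ avoiding both $132$ and $\tau$, and $\mathfrak E_\tau(x)=\sum_{n\ge0}e_\tau(n)x^n$, $\mathfrak O_\tau(x)=\sum_{n\ge0}o_\tau(n)x^n$. Every permutation contains the empty pattern $\emptyset$, so here $\mathfrak E_\emptyset=\mathfrak O_\emptyset=0$. Canonical decomposition: let $\tau\in\mathfrak S_k(132)$, and let $m_0=k,m_1,\dots,m_r$ be the right-to-left maxima of $\tau$ (entries larger than every entry to their right), written from left to right. Then $\tau=(\tau^0,m_0,\tau^1,m_1,\dots,\tau^r,m_r)$, where each $\tau^i$ is a possibly empty word, all of whose entries are greater than $m_{i+1}$ and than all the entries of $\tau^{i+1}$. Prefixes: $\pi^{-1}=\emptyset$, $\pi^0=\tau^0$, and $\pi^i=(\tau^0,m_0,\dots,\tau^i,m_i)$ for $1\le i\le r$. Suffixes: $\sigma^i=(\tau^i,m_i,\dots,\tau^r,m_r)$ for $0\le i\le r$, and $\sigma^{r+1}=\emptyset$. A prefix or suffix is identified with the permutation order-isomorphic to it. *)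

(* Defs.v *)
From HB Require Import structures.
From mathcomp Require Import all_boot all_order all_algebra all_fingroup.
From mathcomp Require Import boolp.
Set Implicit Arguments.
Unset Strict Implicit.
Unset Printing Implicit Defensive.
Import GRing.Theory.
Local Open Scope ring_scope.

(* A record rather than an alias of nat -> R, so that the product is not
   confused with the pointwise product of functions. *)
Record fps (R : Type) := Fps { coefs : nat -> R }.

HB.instance Definition _ (R : Type) := gen_eqMixin (fps R).
HB.instance Definition _ (R : Type) := gen_choiceMixin (fps R).

Section FpsRing.
Variable R : comNzRingType.
Implicit Types (F G H : fps R) (p : {poly R}) (n : nat).

Lemma fpsP F G : (forall n, coefs F n = coefs G n) -> F = G.
Proof. by case: F G => [f] [g] /= fg; congr Fps; apply/funext. Qed.

Definition poly_fps p : fps R := Fps (fun n => p`_n).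

Definition fps_add F G := Fps (fun n => coefs F n + coefs G n).
Definition fps_opp F := Fps (fun n => - coefs F n).
Definition fps_mul F G :=
  Fps (fun n => \sum_(i < n.+1) coefs F i * coefs G (n - i)%N).

Fact fps_addA : associative fps_add.
Proof. by move=> F G H; apply: fpsP => n /=; rewrite addrA. Qed.
Fact fps_addC : commutative fps_add.
Proof. by move=> F G; apply: fpsP => n /=; rewrite addrC. Qed.
Fact fps_add0 : left_id (Fps (fun=> 0)) fps_add.
Proof. by move=> F; apply: fpsP => n /=; rewrite add0r. Qed.
Fact fps_addN : left_inverse (Fps (fun=> 0)) fps_opp fps_add.
Proof. by move=> F; apply: fpsP => n /=; rewrite addNr. Qed.

HB.instance Definition _ :=
  GRing.isZmodule.Build (fps R) fps_addA fps_addC fps_add0 fps_addN.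

Definition fps_trunc n F := \poly_(i < n) coefs F i.

Lemma coef_fps_trunc m n F : (n < m)%N -> (fps_trunc m F)`_n = coefs F n.
Proof. by rewrite coef_poly => ->. Qed.

Lemma coefs_mul_trunc m n F G : (n < m)%N ->
  coefs (fps_mul F G) n = (fps_trunc m F * fps_trunc m G)`_n.
Proof.
move=> ltnm; rewrite coefM /=; apply: eq_bigr => i _.
have lein : (i <= n)%N by rewrite -ltnS.
by rewrite !coef_fps_trunc ?(leq_ltn_trans lein) ?(leq_ltn_trans (leq_subr _ _)).
Qed.

Fact fps_mulA : associative fps_mul.
Proof.
move=> F G H; apply: fpsP => n.
transitivity ((fps_trunc n.+1 F * (fps_trunc n.+1 G * fps_trunc n.+1 H))`_n).
  rewrite coefM; apply: eq_bigr => i _; rewrite coef_fps_trunc //.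
  by rewrite -coefs_mul_trunc // ltnS leq_subr.
rewrite mulrA coefM; apply: eq_bigr => i _.
by rewrite coef_fps_trunc ?ltnS ?leq_subr // -coefs_mul_trunc.
Qed.

Fact fps_mulC : commutative fps_mul.
Proof.
by move=> F G; apply: fpsP => n; rewrite !(coefs_mul_trunc _ _ (ltnSn n)) mulrC.
Qed.

Fact fps_mul1 : left_id (poly_fps 1) fps_mul.
Proof.
move=> F; apply: fpsP => n /=; rewrite big_ord_recl /= coef1 mul1r subn0.
by rewrite big1 ?addr0 // => i _; rewrite coef1 mul0r.
Qed.

Fact fps_mulDl : left_distributive fps_mul fps_add.
Proof.
move=> F G H; apply: fpsP => n /=; rewrite -big_split /=.
by apply: eq_bigr => i _; rewrite mulrDl.
Qed.

Fact fps_oner_neq0 : poly_fps 1 != 0.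
Proof.
apply/eqP => /(congr1 (fun F => coefs F 0)) /= /eqP.
by rewrite coef1 oner_eq0.
Qed.

HB.instance Definition _ :=
  GRing.Zmodule_isComNzRing.Build (fps R)
    fps_mulA fps_mulC fps_mul1 fps_mulDl fps_oner_neq0.

(* F(-x) *)
Definition fps_negX F : fps R := Fps (fun n => (-1) ^+ n * coefs F n).

Definition fps_rational F : Prop :=
  exists p q : {poly R}, q != 0 /\ poly_fps q * F = poly_fps p.

End FpsRing.

(* Permutations of {0, .., n-1} written as words over {1, .., n}. *)
Definition oneline n (s : 'S_n) : seq nat := [seq (val (s i)).+1 | i <- enum 'I_n].

Definition order_iso (u v : seq nat) : bool :=
  (size u == size v) &&
  [forall i : 'I_(size u), forall j : 'I_(size u),
     (nth 0 u i < nth 0 u j)%N == (nth 0 v i < nth 0 v j)%N].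

Definition contains (w t : seq nat) : bool :=
  [exists m : (size w).-tuple bool, order_iso (mask m w) t].

Definition avoids (w t : seq nat) : bool := ~~ contains w t.

(* For a word with distinct entries, the permutation order-isomorphic to it. *)
Definition std (w : seq nat) : seq nat :=
  [seq count (fun y => y <= x)%N w | x <- w].

(* Patterns are given in one-line notation; t = [::] is the empty pattern. *)
Definition num_even (t : seq nat) (n : nat) : nat :=
  #|[set s : 'S_n | [&& avoids (oneline s) [:: 1; 3; 2]%N,
                        avoids (oneline s) t & ~~ odd_perm s]]|.
Definition num_odd (t : seq nat) (n : nat) : nat :=
  #|[set s : 'S_n | [&& avoids (oneline s) [:: 1; 3; 2]%N,
                        avoids (oneline s) t & odd_perm s]]|.

Definition gfE (t : seq nat) : fps rat := Fps (fun n => (num_even t n)%:R).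
Definition gfO (t : seq nat) : fps rat := Fps (fun n => (num_odd t n)%:R).

(* The list of blocks (tau^0, m_0), .., (tau^r, m_r): a block is closed at each
   entry which is larger than every entry to its right; acc is the part of
   the current tau^i already read. *)
Fixpoint blocks_rec (acc w : seq nat) : seq (seq nat * nat) :=
  if w is x :: w' then
    if all (fun y => y < x)%N w' then (acc, x) :: blocks_rec [::] w'
    else blocks_rec (rcons acc x) w'
  else [::].
Definition blocks (w : seq nat) := blocks_rec [::] w.

Definition unblocks (b : seq (seq nat * nat)) : seq nat :=
  flatten [seq rcons t.1 t.2 | t <- b].

Lemma blocksK (w : seq nat) : unblocks (blocks w) = w.
Proof.
suff recK acc : (w == [::]) ==> (acc == [::]) ->
    unblocks (blocks_rec acc w) = acc ++ w by exact: (recK [::] (implybT _)).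
elim: w acc => [|x w IHw] acc /=; first by move=> /eqP->.
move=> _; case: ifP => [_ | /negbT xw].
  by rewrite /unblocks /= -/(unblocks _) IHw ?implybT // cat_rcons.
by rewrite IHw ?cat_rcons //; case: w xw {IHw}.
Qed.

(* pi_prefix b j is pi^(j-1), so the index 0 stands for pi^(-1); pi^0 is tau^0,
   without m_0. *)
Definition pi_prefix (b : seq (seq nat * nat)) (j : nat) : seq nat :=
  match j with
  | 0 => [::]
  | 1 => std (nth ([::], 0) b 0).1
  | _ => std (unblocks (take j b))
  end%N.

Definition sigma_suffix (b : seq (seq nat * nat)) (d : nat) : seq nat :=
  std (unblocks (drop d b)).

(* Main.v *)
From HB Require Import structures.
Require Import Defs.
From mathcomp Require Import all_boot all_order all_algebra all_fingroup.
From mathcomp Require Import ring zify boolp.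
Import GRing.Theory.
Set Implicit Arguments.
Unset Strict Implicit.
Unset Printing Implicit Defensive.

(** Cut a nonempty 132-avoiding permutation at its maximum [n], as [L n R].
    Every entry of [L] exceeds every entry of [R], since otherwise two such
    entries form a 132 with [n]; so [L] and [R] are 132-avoiding permutations
    of sizes [a] and [b], with [a + b + 1 = n], chosen independently
    ([words132_split]).  The inversions are those of [L], those of [R], and the
    [(a + 1) b] pairs formed by an entry of [R] and an entry to its left, so the
    parity is that of [L] plus that of [R], flipped exactly when [a] is even
    and [b] is odd ([odd_inversions_graft]).

    A pattern [t] with blocks [(tau^0, m_0), .., (tau^r, m_r)] occurs in [L n R]
    in one of two ways.  If the occurrence uses [n], then [n] plays the maximum
    [m_0], so that [tau^0] lies in [L] and the rest in [R].  If not, the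
    occurrence cuts [t] into a part in [L] lying above a part in [R], and in a
    132-avoiding word such cuts are exactly those between consecutive blocks
    ([cut_blocks]).  Hence [L n R] contains [t] iff for some [d] the word [L]
    contains [pi^(d-1)] and [R] contains [sigma^d] ([contains_peak]).  As
    containing [pi^d] gets harder, and containing [sigma^d] easier, when [d]
    grows, avoidance means that there is a [d], necessarily unique, such that [L]
    contains [pi^(d-1)] and avoids [pi^d] while [R] avoids [sigma^d]
    ([avoid_telescope]).

    Counting by parity gives a recurrence for the coefficients ([gf_coefS]).
    The flip depends only on the parities of [a] and [b], so the recurrence
    becomes an equation between the even and odd parts of the generating
    functions ([gf_part_rec]), of which the four identities are linear
    combinations.

    Rationality follows by induction on the size of [t].  The patterns [pi^d]
    and [sigma^d] are smaller than [t], except for [sigma^0 = t] and, when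
    [r > 0], [pi^r = t], and these two never meet in one product; so the four
    parts of the generating functions of [t] solve a linear system [v = c + x M v]
    with rational [c] and [M].  Its determinant [det (1 - x M)] has constant
    coefficient 1, and Cramer's rule applies ([rational_system]). *)

(** * Order isomorphism and containment of words *)

Definition same_cmp (p q : nat * nat) : bool := (p.1 < q.1) == (p.2 < q.2).

(** Comparing all pairs of entries of the zipped words, instead of all pairs of
    positions, makes order isomorphism split along concatenations. *)
Lemma order_isoE u v :
  order_iso u v = (size u == size v) && all2rel same_cmp (zip u v).
Proof.
rewrite /order_iso; case: eqP => //= uv.
have szz : size (zip u v) = size u by rewrite size1_zip ?uv.
apply/forallP/allrelP => [iso p q | iso i].
  move=> /(nthP (0, 0)) [i lti <-] /(nthP (0, 0)) [j ltj <-].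
  rewrite szz in lti ltj; rewrite !nth_zip //.
  exact: (forallP (iso (Ordinal lti)) (Ordinal ltj)).
apply/forallP => j; have := iso (nth (0, 0) (zip u v) i) (nth (0, 0) (zip u v) j).
by rewrite !mem_nth ?szz // !nth_zip //; apply.
Qed.

Lemma order_iso_size u v : order_iso u v -> size u = size v.
Proof. by case/andP => /eqP. Qed.

Lemma order_iso_refl u : order_iso u u.
Proof. by rewrite /order_iso eqxx; apply/forallP=> i; apply/forallP. Qed.

Lemma order_iso_sym u v : order_iso u v -> order_iso v u.
Proof.
rewrite /order_iso => /andP [/eqP uv]; rewrite uv eqxx => iso.
apply/forallP=> i; apply/forallP=> j; rewrite eq_sym.
exact: (forallP (forallP iso i) j).
Qed.

Lemma order_iso_trans v u w : order_iso u v -> order_iso v w -> order_iso u w.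
Proof.
rewrite /order_iso => /andP [/eqP uv isouv] /andP [/eqP vw isovw].
rewrite uv vw eqxx; apply/forallP=> i; apply/forallP=> j.
have := forallP (forallP isouv (cast_ord (esym (etrans uv vw)) i))
                (cast_ord (esym (etrans uv vw)) j).
have := forallP (forallP isovw (cast_ord (esym vw) i)) (cast_ord (esym vw) j).
by move=> /eqP /= <- .
Qed.

Lemma order_iso_map (f : nat -> nat) u :
  {in u &, {mono f : x y / x < y}} -> order_iso [seq f x | x <- u] u.
Proof.
move=> mf; rewrite order_isoE size_map eqxx /=.
have -> : zip [seq f x | x <- u] u = [seq (f x, x) | x <- u].
  by rewrite -{2}[u]map_id zip_map.
rewrite allrel_mapl allrel_mapr.
by apply/allrelP => x y xu yu; rewrite /same_cmp /= mf.
Qed.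

Lemma order_iso_std w : order_iso (std w) w.
Proof.
apply: order_iso_map => x y xw yw.
have [xy | yx] := ltnP x y; last first.
  by apply/negbTE; rewrite -leqNgt sub_count // => z /= /leq_trans; apply.
apply: (@leq_trans (count (fun z => z <= x) w + count_mem y w)).
  by rewrite -addn1 leq_add2l -has_count has_pred1.
rewrite -count_predUI (@eq_count _ (predI _ _) pred0) ?count_pred0 ?addn0.
  by apply: sub_count => z /= /orP [zx | /eqP -> //]; apply: leq_trans zx (ltnW xy).
by move=> z /=; apply/negP => /andP [zx /eqP zy]; rewrite zy leqNgt xy in zx.
Qed.

Definition above (u v : seq nat) : bool := allrel (fun x y => y < x) u v.
Definition below (u v : seq nat) : bool := allrel (fun x y => x < y) u v.

Lemma above_subseq u v u' v' :
  subseq u' u -> subseq v' v -> above u v -> above u' v'.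
Proof.
move=> /mem_subseq su /mem_subseq sv /allrelP uv.
by apply/allrelP => x y /su xu /sv yv; apply: uv.
Qed.

Lemma allrel_zip (r : rel nat) u1 u2 v1 v2 :
  size u1 = size v1 -> size u2 = size v2 ->
  (allrel r u1 u2 = allrel (fun p q => r p.1 q.1) (zip u1 v1) (zip u2 v2)) *
  (allrel r v1 v2 = allrel (fun p q => r p.2 q.2) (zip u1 v1) (zip u2 v2)).
Proof.
move=> s1 s2; split.
  by rewrite -{1}(@unzip1_zip _ _ u1 v1) ?s1 // -{1}(@unzip1_zip _ _ u2 v2) ?s2 //
             /unzip1 allrel_mapl allrel_mapr.
by rewrite -{1}(@unzip2_zip _ _ u1 v1) ?s1 // -{1}(@unzip2_zip _ _ u2 v2) ?s2 //
           /unzip2 allrel_mapl allrel_mapr.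
Qed.

(** An occurrence of a concatenation is cut into occurrences of its factors; the
    relative height of the two factors is read off the comparisons across the
    cut, hence is the same in both words. *)
Lemma order_iso_split u1 u2 t : order_iso (u1 ++ u2) t ->
  exists t1 t2, [/\ t = t1 ++ t2, order_iso u1 t1, order_iso u2 t2,
                    above u1 u2 = above t1 t2 & below u1 u2 = below t1 t2].
Proof.
move=> iso; have szt := order_iso_size iso; rewrite size_cat in szt.
move: iso; rewrite -(cat_take_drop (size u1) t) order_isoE.
set t1 := take _ t; set t2 := drop _ t.
have s1 : size u1 = size t1 by rewrite size_take_min -szt; lia.
have s2 : size u2 = size t2 by rewrite size_drop -szt; lia.
rewrite zip_cat // allrel_catl !allrel_catr => /andP [_].
case/andP=> /andP [a11 /allrelP a12] /andP [/allrelP a21 a22].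
exists t1, t2; split; rewrite ?order_isoE ?s1 ?s2 ?eqxx //.
  rewrite /above !(allrel_zip _ s1 s2).
  apply: (eq_in_allrel (P := mem (zip u1 t1)) (Q := mem (zip u2 t2))); [|exact/allP..].
  by move=> p q pz qz; rewrite (eqP (a21 q p qz pz)).
rewrite /below !(allrel_zip _ s1 s2).
apply: (eq_in_allrel (P := mem (zip u1 t1)) (Q := mem (zip u2 t2))); [|exact/allP..].
by move=> p q pz qz; rewrite (eqP (a12 p q pz qz)).
Qed.

Lemma mem_zip (u v : seq nat) p : p \in zip u v -> (p.1 \in u) && (p.2 \in v).
Proof.
elim: u v => [|x u IHu] [|y v] //= ; rewrite !inE => /orP [/eqP -> | /IHu /andP [-> ->]].
  by rewrite !eqxx.
by rewrite !orbT.
Qed.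

(** Skew position decides every comparison across the cut, so that occurrences
    of the two factors glue. *)
Lemma order_iso_cat u1 u2 v1 v2 : order_iso u1 v1 -> order_iso u2 v2 ->
  above u1 u2 -> above v1 v2 -> order_iso (u1 ++ u2) (v1 ++ v2).
Proof.
rewrite !order_isoE => /andP [/eqP s1 a1] /andP [/eqP s2 a2] /allrelP au /allrelP av.
rewrite !size_cat s1 s2 eqxx zip_cat // allrel_catl !allrel_catr a1 a2 andbT /=.
have cross p q : p \in zip u1 v1 -> q \in zip u2 v2 -> same_cmp p q && same_cmp q p.
  move=> /mem_zip /andP [pu pv] /mem_zip /andP [qu qv].
  have qp1 : q.1 < p.1 := au _ _ pu qu; have qp2 : q.2 < p.2 := av _ _ pv qv.
  by rewrite /same_cmp qp1 qp2 ltnNge (ltnW qp1) ltnNge (ltnW qp2).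
by apply/andP; split; apply/allrelP => p q pz qz;
  [case/andP: (cross _ _ pz qz) | case/andP: (cross _ _ qz pz)].
Qed.

(** The shape of a 132-avoiding word cut at its maximum [m]. *)
Definition peak u m v := [&& all (ltn^~ m) u, all (ltn^~ m) v & above u v].

Lemma peak_subseq u m v u' v' :
  subseq u' u -> subseq v' v -> peak u m v -> peak u' m v'.
Proof.
move=> su sv /and3P [um vm uv]; apply/and3P; split; last exact: above_subseq uv.
  by apply/allP => x /(mem_subseq su) /(allP um).
by apply/allP => x /(mem_subseq sv) /(allP vm).
Qed.

Lemma order_iso_peak u1 m u2 v1 x v2 : order_iso u1 v1 -> order_iso u2 v2 ->
  peak u1 m u2 -> peak v1 x v2 -> order_iso (u1 ++ m :: u2) (v1 ++ x :: v2).
Proof.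
move=> i1 i2 /and3P [um mu au] /and3P [vx xv av].
rewrite -!cat_rcons; apply: order_iso_cat => //; last first.
- by rewrite -cats1 /above allrel_catl [allrel _ v1 _]av allrel1l.
- by rewrite -cats1 /above allrel_catl [allrel _ u1 _]au allrel1l.
move: i1; rewrite !order_isoE !size_rcons => /andP [/eqP s1 a1].
rewrite s1 eqxx -!cats1 zip_cat // allrel_catl !allrel_catr a1 /= allrel1r !allrel1l /=.
rewrite /same_cmp /= !ltnn eqxx !andbT.
apply/andP; split; apply/allP => p /mem_zip /andP [pu pv] /=.
  by rewrite (allP um _ pu : _ < _) (allP vx _ pv : _ < _).
by rewrite ltnNge (ltnW (allP um _ pu)) ltnNge (ltnW (allP vx _ pv)).
Qed.

(** The maximum of a word corresponds to the maximum of any order-isomorphic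
    word, and the skew position of the two sides is transported with it. *)
Lemma order_iso_peak_split u1 m u2 t : order_iso (u1 ++ m :: u2) t -> peak u1 m u2 ->
  exists t1 x t2, [/\ t = t1 ++ x :: t2, order_iso u1 t1, order_iso u2 t2
                     & peak t1 x t2].
Proof.
(* Cutting after [m] sees that both [u1] and [m] lie above [u2]; a second cut
   before [m] sees that [u1] lies below [m]. *)
rewrite -cat_rcons => /order_iso_split [t' [t2 [-> iso1 iso2 abv _]]] /and3P [um mu au].
rewrite -cats1 in iso1; case: (order_iso_split iso1) => t1 [w [et' iso1' isow _ blw]].
have := order_iso_size isow; case: w => [|x []] // in et' isow blw * => _.
exists t1, x, t2; split => //; first by rewrite et' -catA.
move: abv; rewrite et' -cats1 /above !allrel_catl !allrel1l [allrel _ u1 _]au mu /=.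
move/esym/andP => [abv xt2]; rewrite /peak xt2 -/(above _ _) [above _ _]abv !andbT.
by move: blw; rewrite /below !allrel1r => <-.
Qed.

Lemma containsP w t : reflect (exists2 u, subseq u w & order_iso u t) (contains w t).
Proof.
apply: (iffP existsP) => [[m iso] | [u /subseqP [m /eqP szm ->] iso]].
  by exists (mask m w); rewrite // mask_subseq.
by exists (Tuple szm).
Qed.

Lemma contains_nil w : contains w [::].
Proof. by apply/containsP; exists [::]; rewrite ?sub0seq ?order_iso_refl. Qed.

Lemma contains_subseq w w' t : subseq w w' -> contains w t -> contains w' t.
Proof.
by move=> ww' /containsP [u uw iso]; apply/containsP; exists u => //; apply: subseq_trans ww'.
Qed.

Lemma order_iso_contains w t t' : order_iso t t' -> contains w t -> contains w t'.
Proof.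
by move=> tt' /containsP [u uw iso]; apply/containsP; exists u => //; apply: order_iso_trans tt'.
Qed.

(** Patterns matter only up to order isomorphism, so that prefixes and suffixes
    of a pattern can be used without standardizing them. *)
Lemma contains_std w t : contains w (std t) = contains w t.
Proof.
by apply/idP/idP; apply: order_iso_contains; last apply: order_iso_sym; apply: order_iso_std.
Qed.

Lemma subseq_catP (T : eqType) (u s1 s2 : seq T) :
  reflect (exists u1 u2, [/\ u = u1 ++ u2, subseq u1 s1 & subseq u2 s2])
          (subseq u (s1 ++ s2)).
Proof.
apply: (iffP idP) => [|[u1 [u2 [-> su1 su2]]]]; last exact: cat_subseq.
case/subseqP => m szm ->; rewrite size_cat in szm.
exists (mask (take (size s1) m) s1), (mask (drop (size s1) m) s2).
split; rewrite ?mask_subseq //.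
by rewrite -mask_cat ?cat_take_drop // size_take_min szm; lia.
Qed.

Lemma contains_cat w t1 t2 : contains w (t1 ++ t2) -> contains w t1 && contains w t2.
Proof.
case/containsP => u uw /order_iso_sym /order_iso_split [u1 [u2 [eu i1 i2 _ _]]].
rewrite {}eu in uw; apply/andP; split; apply/containsP.
  by exists u1; [apply: subseq_trans (prefix_subseq _ _) uw | apply: order_iso_sym].
by exists u2; [apply: subseq_trans (suffix_subseq _ _) uw | apply: order_iso_sym].
Qed.

Lemma order_iso_132 u : reflect (exists x y z, u = [:: x; y; z] /\ x < z < y)
  (order_iso u [:: 1; 3; 2]).
Proof.
rewrite order_isoE; apply: (iffP idP) => [/andP [] | [x [y [z [-> /andP [xz zy]]]]]].
  case: u => [|x [|y [|z []]]] // _ cmp; exists x, y, z; split=> //.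
  by move: cmp; rewrite /allrel /same_cmp /=; lia.
by rewrite /allrel /same_cmp /=; lia.
Qed.

Lemma contains_132 w : reflect (exists x y z, subseq [:: x; y; z] w /\ x < z < y)
  (contains w [:: 1; 3; 2]).
Proof.
apply: (iffP (containsP _ _)) => [[u uw /order_iso_132 [x [y [z [eu xyz]]]]] | ].
  by exists x, y, z; rewrite -eu.
case=> x [y [z [uw xyz]]]; exists [:: x; y; z] => //.
by apply/order_iso_132; exists x, y, z.
Qed.

(** * Blocks of a 132-avoiding pattern and its occurrences *)

(** Distinct entries and no 132: up to order isomorphism, a 132-avoiding
    permutation.  Unlike the latter, the class is closed under subwords. *)
Definition uniq132 t := uniq t && avoids t [:: 1; 3; 2].

Lemma uniq132_subseq t t' : subseq t' t -> uniq132 t -> uniq132 t'.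
Proof.
move=> tt' /andP [ut av]; rewrite /uniq132 (subseq_uniq tt') //=.
by apply: contra av; apply: contains_subseq.
Qed.

(** An entry before the maximum and a larger one after it would form a 132 with
    the maximum in between. *)
Lemma uniq132_peak u m v : all (ltn^~ m) u -> all (ltn^~ m) v -> uniq132 (u ++ m :: v) ->
  peak u m v.
Proof.
move=> um vm /andP [ut av]; rewrite /peak um vm.
apply/allrelP => x z xu zv; rewrite ltn_neqAle.
have -> : z != x.
  apply: contraTneq ut => zx; rewrite cat_uniq.
  have -> : has (mem u) (m :: v); last by rewrite /= andbF.
  by apply/hasP; exists z; rewrite ?inE ?zv ?orbT //= zx.
rewrite leqNgt; apply: contra av => xz; apply/contains_132.
exists x, m, z; rewrite xz (allP vm _ zv : _ < _); split=> //.
by rewrite -[[:: x; _; _]]/([:: x] ++ _) cat_subseq ?sub1seq //= eqxx sub1seq.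
Qed.

Lemma uniq132_decomp t : uniq132 t -> t != [::] ->
  exists t1 x t2, t = t1 ++ x :: t2 /\ peak t1 x t2.
Proof.
move=> gt tn0.
have [x xt xmax] : exists2 x, x \in t & all (leq^~ x) t.
  elim: t tn0 {gt} => // y t IHt _; case: (altP (t =P [::])) => [-> | /IHt [x xt xmax]].
    by exists y; rewrite ?inE //= leqnn.
  have [yx | xy] := leqP y x; first by exists x; rewrite ?inE ?xt ?orbT //= yx.
  exists y; rewrite ?inE ?eqxx //= leqnn /=; apply: sub_all xmax => z /= zx.
  exact: leq_trans zx (ltnW xy).
case/splitPr: xt xmax gt tn0 => t1 t2; rewrite all_cat /= leqnn /= => /andP [le1 le2] gt _.
exists t1, x, t2; split=> //; apply: uniq132_peak => //.
  apply/allP => y yt /=; rewrite ltn_neqAle (allP le1 _ yt : _ <= _) andbT.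
  case/andP: gt => + _; rewrite cat_uniq /= => /and3P [_ /norP [+ _] _].
  by apply: contra => /eqP <-.
apply/allP => y yt /=; rewrite ltn_neqAle (allP le2 _ yt : _ <= _) andbT.
case/andP: gt => + _; rewrite cat_uniq /= => /and4P [_ _ + _].
by apply: contra => /eqP <-.
Qed.

(** The first right-to-left maximum is the maximum, so the blocks after the
    first one are those of the part after the maximum. *)
Lemma blocks_peak t1 x t2 : peak t1 x t2 -> blocks (t1 ++ x :: t2) = (t1, x) :: blocks t2.
Proof.
case/and3P => t1x t2x _; suff rec acc :
    blocks_rec acc (t1 ++ x :: t2) = (acc ++ t1, x) :: blocks t2 by exact: rec.
elim: t1 t1x acc => [_|y t1 IHt1 /= /andP [yx t1x]] acc /=.
  by rewrite t2x cats0.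
rewrite all_cat /= [x < y]ltnNge ltnW // andbF.
by rewrite IHt1 // cat_rcons.
Qed.

Lemma unblocks_cons t1 x b : unblocks ((t1, x) :: b) = t1 ++ x :: unblocks b.
Proof. by rewrite /unblocks /= cat_rcons. Qed.

Lemma unblocks_cat b c : unblocks (b ++ c) = unblocks b ++ unblocks c.
Proof. by rewrite /unblocks map_cat flatten_cat. Qed.

Lemma take_drop_blocks j t :
  unblocks (take j (blocks t)) ++ unblocks (drop j (blocks t)) = t.
Proof. by rewrite -unblocks_cat cat_take_drop blocksK. Qed.

(** Induction along the blocks of a pattern. *)
Lemma uniq132_ind (P : seq nat -> Prop) : P [::] ->
  (forall t1 x t2, peak t1 x t2 -> uniq132 (t1 ++ x :: t2) -> uniq132 t2 -> P t2 ->
     P (t1 ++ x :: t2)) ->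
  forall t, uniq132 t -> P t.
Proof.
move=> P0 PS t; have [n] := ubnP (size t); elim: n t => // n IHn t szt gt.
case: (altP (t =P [::])) => [-> // | /(uniq132_decomp gt) [t1 [x [t2 [et pk]]]]].
rewrite {}et in szt gt *.
have gt2 : uniq132 t2.
  by apply: uniq132_subseq gt; rewrite -cat_rcons suffix_subseq.
by apply: PS => //; apply: IHn => //; move: szt; rewrite size_cat /=; lia.
Qed.

(** Both the part before the maximum and the maximum lie above the rest, and so
    on in the rest: each block lies above all later ones. *)
Lemma above_blocks t j : uniq132 t ->
  above (unblocks (take j (blocks t))) (unblocks (drop j (blocks t))).
Proof.
move=> gt; elim/uniq132_ind: gt j => [|t1 x t2 pk gt gt2 IH] j; first by case: j.
rewrite blocks_peak //; case: j => [|j] /=; first exact: allrel0l.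
rewrite unblocks_cons.
case/and3P: pk => _ t2x abv.
have sub : subseq (unblocks (drop j (blocks t2))) t2.
  by rewrite -{2}(take_drop_blocks j t2) suffix_subseq.
rewrite /above allrel_catl allrel_consl; apply/and3P; split; last exact: IH.
  exact: above_subseq (subseq_refl _) sub abv.
by apply/allP => y /(mem_subseq sub) /(allP t2x).
Qed.

(** No other cut is in skew position, apart from the one with an empty left part:
    a nonempty left part must contain the maximum [x], and what it contains after
    [x] starts a cut, again in skew position, of the part after [x]. *)
Lemma cut_blocks t p s : uniq132 t -> t = p ++ s -> p != [::] -> above p s ->
  exists2 j, 0 < j <= size (blocks t) &
    p = unblocks (take j (blocks t)) /\ s = unblocks (drop j (blocks t)).
Proof.
move=> gt; elim/uniq132_ind: gt p s => [|t1 x t2 pk gt gt2 IH] p s; first by case: p.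
rewrite blocks_peak // => ec pn0 abv; case/and3P: (pk) => t1x t2x _.
have [p' [ep et2]] : exists p', p = t1 ++ x :: p' /\ t2 = p' ++ s.
  have xt : x \in p ++ s by rewrite -ec mem_cat inE eqxx orbT.
  have xp : x \in p.
    move: xt; rewrite mem_cat => /orP [// | xs].
    case: p pn0 abv ec {IH} => // y p _ /allrelP abv ec.
    have xy : x < y by apply: abv; rewrite ?inE ?eqxx.
    have : y \in t1 ++ x :: t2 by rewrite ec inE eqxx.
    rewrite mem_cat inE => /or3P [/(allP t1x) | /eqP | /(allP t2x)] /=; lia.
  case/splitPr: xp ec {abv pn0 xt} => p1 p2; rewrite -catA /= => ec.
  have [ut _] := andP gt.
  have xt1 : x \notin t1 by apply/negP => /(allP t1x) /=; rewrite ltnn.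
  have xp1 : x \notin p1.
    by move: ut; rewrite ec cat_uniq => /and3P [_ /= /norP []].
  have sz : size t1 = size p1.
    have := congr1 (index x) ec; rewrite !index_cat (negbTE xt1) (negbTE xp1) /= eqxx.
    by rewrite !addn0.
  by move/eqP: ec; rewrite eqseq_cat // => /andP [/eqP -> /eqP [->]]; exists p2.
case: (altP (p' =P [::])) => [p'0 | p'n0].
  by exists 1 => //=; rewrite take0 drop0 unblocks_cons blocksK ep et2 p'0.
have [|j lej [ep' es]] := IH p' s et2 p'n0.
  apply: above_subseq abv => //; rewrite ep -cat_rcons; exact: suffix_subseq.
by exists j.+1; [case/andP: lej | rewrite /= unblocks_cons -ep' -es ep].
Qed.

(** The words that [pi_prefix] and [sigma_suffix] standardize. *)
Definition prefix_word (b : seq (seq nat * nat)) (j : nat) : seq nat :=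
  match j with
  | 0 => [::]
  | 1 => (nth ([::], 0) b 0).1
  | _ => unblocks (take j b)
  end.
Definition suffix_word (b : seq (seq nat * nat)) d : seq nat := unblocks (drop d b).

Lemma pi_prefixE b j : pi_prefix b j = std (prefix_word b j).
Proof. by case: j => [|[|j]]. Qed.

Lemma contains_prefixS u b d :
  contains u (prefix_word b d.+1) -> contains u (prefix_word b d).
Proof.
case: d => [|[|d]]; first by rewrite contains_nil.
  case: b => [|[t1 x] b] //.
  by rewrite /prefix_word /= unblocks_cons => /contains_cat /andP [].
rewrite /prefix_word -addn1 takeD unblocks_cat.
by case/contains_cat/andP.
Qed.

Lemma contains_suffixS u b d :
  contains u (suffix_word b d) -> contains u (suffix_word b d.+1).
Proof.
rewrite /suffix_word -[d.+1]addn1 addnC -drop_drop.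
rewrite -{1}(cat_take_drop 1 (drop d b)) unblocks_cat.
by case/contains_cat/andP.
Qed.

(** An occurrence of [t] that uses the maximum [m] of the text uses it for the
    maximum of [t], which is the case [d = 1].  One that does not use [m] induces
    a cut of [t] in skew position, which is the case [d = 0] if its left part is
    empty, and otherwise is described by [cut_blocks].  Conversely the two parts
    glue, with [m] added between them if [d = 1], as [prefix_word _ 1] lacks the
    maximum of [t]. *)
Lemma contains_peak u m v t : uniq132 t -> t != [::] -> peak u m v ->
  contains (u ++ m :: v) t = has (fun d => contains u (prefix_word (blocks t) d)
                                           && contains v (suffix_word (blocks t) d))
                                 (iota 0 (size (blocks t)).+1).
Proof.
move=> gt tn0 pk; case/and3P: (pk) => um vm uv.
have [t1 [x [t2 [et pkt]]]] := uniq132_decomp gt tn0.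
apply/idP/hasP.
  case/containsP => w /subseq_catP [u1 [w2 [ew su1 sw2]]] iso.
  have [u2 [ew2|ew2] su2] : exists2 u2, w2 = m :: u2 \/ w2 = u2 & subseq u2 v.
    case: w2 sw2 {ew} => [|y w2] /=; first by exists [::]; [right | rewrite sub0seq].
    case: eqP => [-> | _] sw2; first by exists w2; [left|].
    by exists (y :: w2); [right|].
  - rewrite {}ew {}ew2 in iso sw2.
    have [|t1' [x' [t2' [et' i1 i2 pkt']]]] := order_iso_peak_split iso.
      exact: peak_subseq su1 su2 pk.
    exists 1; first by rewrite et' blocks_peak // mem_iota.
    rewrite /suffix_word et' blocks_peak //= drop0 blocksK.
    by apply/andP; split; apply/containsP; [exists u1 | exists u2].
  rewrite {}ew {}ew2 in iso.
  have [p [s [ets i1 i2 abv _]]] := order_iso_split iso.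
  move: abv; rewrite (above_subseq su1 su2) // => /esym abv.
  case: (altP (p =P [::])) => [p0 | pn0].
    exists 0; first by rewrite mem_iota.
    rewrite contains_nil /suffix_word drop0 blocksK ets p0.
    by apply/containsP; exists u2.
  have [j /andP [j0 lej] [ep es]] := cut_blocks gt ets pn0 abv.
  exists j; first by rewrite mem_iota /= add0n ltnS.
  rewrite /suffix_word -es; apply/andP; split; last by apply/containsP; exists u2.
  (* For [j = 1] the occurrence in [u] includes the maximum of [t], which
     [prefix_word _ 1] omits. *)
  have : contains u p by apply/containsP; exists u1.
  rewrite ep; case: j j0 {lej ep es} => [|[|j]] // _.
  rewrite et blocks_peak //= unblocks_cons.
  by case/contains_cat/andP.
case=> d _ /andP [/containsP [u1 su1 i1] /containsP [u2 su2 i2]].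
apply/containsP; case: d i1 i2 => [|[|d]].
- rewrite /suffix_word drop0 blocksK => _ i2; exists u2 => //.
  by apply: subseq_trans su2 _; rewrite -cat_rcons suffix_subseq.
- rewrite /suffix_word {1}et {1}(congr1 blocks et) blocks_peak //= drop0 blocksK => i1 i2.
  exists (u1 ++ m :: u2); first by rewrite cat_subseq //= eqxx.
  rewrite et; apply: order_iso_peak => //.
  exact: peak_subseq su1 su2 pk.
rewrite /prefix_word /suffix_word => i1 i2; exists (u1 ++ u2).
  by rewrite cat_subseq // (subseq_trans su2) // subseq_cons.
rewrite -(take_drop_blocks d.+2 t); apply: order_iso_cat => //.
  exact: above_subseq su1 su2 uv.
exact: above_blocks.
Qed.

(** * 132-avoiding permutations cut at the maximum *)

Fixpoint inversions (w : seq nat) : nat :=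
  if w is x :: w' then count (ltn^~ x) w' + inversions w' else 0.

Lemma inversions_insert_max u m v : all (ltn^~ m) u -> all (ltn^~ m) v ->
  inversions (u ++ m :: v) = inversions (u ++ v) + size v.
Proof.
elim: u => [_ vm|x u IHu /= /andP [xm um] vm] /=.
  by rewrite addnC; congr (_ + _); apply/eqP; rewrite -all_count.
by rewrite IHu // !count_cat /= [m < x]ltnNge (ltnW xm) /=; lia.
Qed.

Lemma inversions_above u v : above u v ->
  inversions (u ++ v) = inversions u + inversions v + size u * size v.
Proof.
elim: u => [|x u IHu] /=; first by rewrite addn0.
rewrite /above allrel_consl => /andP [xv /IHu ->].
by rewrite count_cat; move: xv; rewrite all_count => /eqP ->; lia.
Qed.

(** Besides the inversions within [u] and within [v], each entry of [v] forms one
    with [m] and with every entry of [u]. *)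
Lemma inversions_peak u m v : peak u m v ->
  inversions (u ++ m :: v) = inversions u + inversions v + (size u).+1 * size v.
Proof. by case/and3P => um vm uv; rewrite inversions_insert_max // inversions_above //; lia. Qed.

Lemma inversions_shift b u : inversions [seq b + x | x <- u] = inversions u.
Proof.
elim: u => //= x u ->; congr (_ + _); rewrite count_map.
by apply: eq_count => y /=; rewrite ltn_add2l.
Qed.

Lemma contains_shift b w t : contains [seq b + x | x <- w] t = contains w t.
Proof.
have iso u : order_iso [seq b + x | x <- u] u.
  by apply: order_iso_map => x y _ _; rewrite ltn_add2l.
apply/containsP/containsP => [[u /subseqP [m szm ->]]|[u uw ut]].
  rewrite -map_mask => ut; exists (mask m w); first exact: mask_subseq.
  exact: order_iso_trans (order_iso_sym (iso _)) ut.
by exists [seq b + x | x <- u]; [exact: map_subseq | exact: order_iso_trans ut].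
Qed.

Lemma size_oneline n (s : 'S_n) : size (oneline s) = n.
Proof. by rewrite size_map size_enum_ord. Qed.

Lemma nth_oneline n (s : 'S_n) (k : 'I_n) : nth 0 (oneline s) k = (s k).+1.
Proof. by rewrite (nth_map k) ?size_enum_ord // nth_ord_enum. Qed.

Lemma oneline_inj n : injective (@oneline n).
Proof.
move=> s s' e; apply/permP => k; apply/val_inj/succn_inj.
by rewrite -!nth_oneline e.
Qed.

Lemma uniq_oneline n (s : 'S_n) : uniq (oneline s).
Proof.
rewrite map_inj_uniq ?enum_uniq // => i j /= [] /val_inj; exact: perm_inj.
Qed.

Lemma perm_oneline n (s : 'S_n) : perm_eq (oneline s) (iota 1 n).
Proof.
apply: uniq_perm; rewrite ?uniq_oneline ?iota_uniq //.
have sub : {subset oneline s <= iota 1 n}.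
  by move=> x /mapP [i _ ->]; rewrite mem_iota /= add1n ltnS ltn_ord.
by case: (uniq_min_size (uniq_oneline s) sub); rewrite ?size_iota ?size_oneline.
Qed.

Lemma perm_iota_oneline n w : perm_eq w (iota 1 n) -> exists s : 'S_n, w = oneline s.
Proof.
move=> pw; have szw : size w = n by rewrite (perm_size pw) size_iota.
have uw : uniq w by rewrite (perm_uniq pw) iota_uniq.
have nthw (k : 'I_n) : 0 < nth 0 w k <= n.
  have : nth 0 w k \in iota 1 n by rewrite -(perm_mem pw) mem_nth ?szw.
  by rewrite mem_iota add1n ltnS.
have ltw (k : 'I_n) : (nth 0 w k).-1 < n by have := nthw k; lia.
have inj : injective (fun k => Ordinal (ltw k)).
  have szk (k : 'I_n) : k < size w by rewrite szw.
  move=> i j [] eij; apply: val_inj; apply/eqP.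
  rewrite -(nth_uniq 0 (szk i) (szk j) uw); apply/eqP.
  have /andP [i0 _] := nthw i; have /andP [j0 _] := nthw j.
  by rewrite -(prednK i0) eij prednK.
exists (perm inj); apply: (@eq_from_nth _ 0); rewrite ?size_oneline // szw => k ltk.
rewrite (nth_oneline _ (Ordinal ltk)) permE /= prednK //.
by case/andP: (nthw (Ordinal ltk)).
Qed.

(** In one-line notation, [s'] is [s] without its maximum, whose position is [i]. *)
Lemma perm_lift_max n (s : 'S_n.+1) : exists i s', s = lift_perm i ord_max s'.
Proof.
pose i := (s^-1)%g ord_max; have si : s i = ord_max by rewrite permKV.
pose f k := odflt k (unlift ord_max (s (lift i k))).
have fK k : lift ord_max (f k) = s (lift i k).
  rewrite /f; have := neq_lift i k.
  by rewrite -(inj_eq (@perm_inj _ s)) si => /unlift_some [? ? ->].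
have inj : injective f.
  by move=> k k' e; have := fK k; rewrite e fK => /perm_inj /lift_inj.
exists i; exists (perm inj); apply/permP => k.
case: (unliftP i k) => [k' -> | ->]; last by rewrite lift_perm_id.
by rewrite lift_perm_lift permE fK.
Qed.

Lemma oneline_lift_max n (i : 'I_n.+1) (s : 'S_n) :
  oneline (lift_perm i ord_max s) = take i (oneline s) ++ n.+1 :: drop i (oneline s).
Proof.
have szt : size (take i (oneline s)) = i.
  by rewrite size_take_min size_oneline; have := ltn_ord i; lia.
apply: (@eq_from_nth _ 0) => [|k].
  by rewrite size_cat szt /= size_drop !size_oneline; have := ltn_ord i; lia.
rewrite size_oneline => ltk; rewrite (nth_oneline _ (Ordinal ltk)) nth_cat szt.
case: (unliftP i (Ordinal ltk)) => [j | ] ek; rewrite ek.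
  have -> : k = bump i j by rewrite -[k]/(val (Ordinal ltk)) ek.
  rewrite lift_perm_lift lift_max -nth_oneline /bump; have [ij | ji] := leqP i j.
    by rewrite add1n ltnNge (leq_trans ij (leqnSn _)) /= subSn //= nth_drop subnKC.
  by rewrite add0n ji nth_take.
have -> : k = i by rewrite -[k]/(val (Ordinal ltk)) ek.
by rewrite lift_perm_id ltnn subnn.
Qed.

(** By induction on the size: the maximum, in position [i] among [0 .. n], is the
    larger entry of [n - i] inversions, and [odd_lift_perm] says that removing
    it changes the sign by the parity of [i + n]. *)
Lemma odd_oneline n (s : 'S_n) : odd_perm s = odd (inversions (oneline s)).
Proof.
elim: n s => [|n IHn] s.
  have -> : s = 1%g by apply/permP => [[]].
  by rewrite odd_perm1 /oneline enum_ord0 //; have := size_oneline (1%g : 'S_0); case: oneline.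
have [i [s' ->]] := perm_lift_max s.
have small : all (ltn^~ n.+1) (oneline s').
  by apply/allP => x; rewrite (perm_mem (perm_oneline s')) mem_iota add1n => /andP [].
rewrite odd_lift_perm oneline_lift_max inversions_insert_max; last 2 first.
- by apply/allP => x /mem_take /(allP small).
- by apply/allP => x /mem_drop /(allP small).
rewrite cat_take_drop size_drop size_oneline oddD (oddB (leq_ord i)) IHn /=.
by case: (odd i); case: (odd n); case: (odd _).
Qed.

Definition words132 n : seq (seq nat) :=
  [seq w <- [seq oneline s | s <- enum 'S_n] | avoids w [:: 1; 3; 2]].

Lemma mem_words132 n w :
  (w \in words132 n) = perm_eq w (iota 1 n) && avoids w [:: 1; 3; 2].
Proof.
rewrite mem_filter andbC; congr (_ && _); apply/mapP/idP => [[s _ ->] | ].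
  exact: perm_oneline.
by case/perm_iota_oneline => s ->; exists s; rewrite ?mem_enum.
Qed.

Lemma uniq_words132 n : uniq (words132 n).
Proof. by rewrite filter_uniq // map_inj_uniq ?enum_uniq //; apply: oneline_inj. Qed.

(** The 132-avoiding permutation cut at its maximum into [L] and [R]; the entries
    of [L] are shifted above those of [R]. *)
Definition graft (L R : seq nat) : seq nat :=
  [seq size R + x | x <- L] ++ (size L + size R).+1 :: R.

(** Sorting [v] and then [u] sorts the whole word, so [v] takes the smallest
    values and [u] the largest ones. *)
Lemma above_perm_iota u v n : above u v -> perm_eq (u ++ v) (iota 1 n) ->
  perm_eq v (iota 1 (size v)) /\ perm_eq u (iota (size v).+1 (size u)).
Proof.
move=> uv puv; have en : size v + size u = n.
  by rewrite addnC -size_cat (perm_size puv) size_iota.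
have : sort leq v ++ sort leq u = iota 1 n.
  apply: (sorted_eq leq_trans anti_leq); last 2 first.
  - exact: iota_sorted.
  - by rewrite perm_catC (perm_trans _ puv) // perm_cat // perm_sort.
  rewrite sorted_pairwise; last exact: leq_trans.
  rewrite pairwise_cat -!sorted_pairwise ?sort_sorted; try exact: leq_trans; try exact: leq_total.
  rewrite !andbT; apply/allrelP => x y; rewrite !mem_sort => xv yu.
  exact/ltnW/(allrelP uv).
rewrite -en iotaD => /eqP; rewrite eqseq_cat ?size_sort ?size_iota // add1n.
by case/andP => /eqP <- /eqP <-; rewrite ![perm_eq _ (sort _ _)]perm_sym !perm_sort.
Qed.

Lemma graft_peak L R a b : perm_eq L (iota 1 a) -> perm_eq R (iota 1 b) ->
  peak [seq b + x | x <- L] (a + b).+1 R.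
Proof.
move=> pL pR.
have inL x : x \in L -> 0 < x <= a by rewrite (perm_mem pL) mem_iota add1n ltnS.
have inR x : x \in R -> 0 < x <= b by rewrite (perm_mem pR) mem_iota add1n ltnS.
apply/and3P; split.
- by apply/allP => _ /mapP [x /inL xL ->] /=; lia.
- by apply/allP => x /inR xR /=; lia.
by apply/allrelP => _ y /mapP [x /inL xL ->] /inR yR; lia.
Qed.

(** The last entry of a 132 that starts in [u] and leaves it exceeds the first
    one, so it can only be [m], and then the middle entry exceeds [m]; and no 132
    starts at [m]. *)
Lemma peak_avoids_132 u m v : peak u m v ->
  avoids u [:: 1; 3; 2] -> avoids v [:: 1; 3; 2] -> avoids (u ++ m :: v) [:: 1; 3; 2].
Proof.
case/and3P => um vm /allrelP uv au av; apply/negP => /contains_132.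
case=> x [y [z [/subseq_catP [w1 [w2 [ew sw1 sw2]]] /andP [xz zy]]]].
have inmv k : k \in w2 -> k <= m.
  by move/(mem_subseq sw2); rewrite inE => /orP [/eqP -> // | /(allP vm) /ltnW].
have inversions' k l : k \in w1 -> l \in w2 -> k < l -> l = m.
  move/(mem_subseq sw1) => ku /(mem_subseq sw2); rewrite inE => /orP [/eqP // | lv].
  by have := uv _ _ ku lv; lia.
case: w1 ew sw1 inversions' => [|x' [|y' [|z' []]]] //=.
- move=> ew _ _; rewrite -ew /= in sw2 inmv.
  have := inmv y; rewrite !inE eqxx orbT => /(_ isT) ym.
  move: sw2; case: eqP => [xm | _ sw2]; first by lia.
  by case/negP: av; apply/contains_132; exists x, y, z; rewrite xz zy.
- case=> <- ew _ inversions'; rewrite -ew in inmv inversions'.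
  have := inversions' x z; rewrite !inE !eqxx !orbT => /(_ isT isT xz) zm.
  by have := inmv y; rewrite !inE eqxx => /(_ isT); lia.
- case=> <- <- ew sw1 inversions'; rewrite -ew in inmv inversions'.
  have := inversions' x z; rewrite !inE !eqxx => /(_ isT isT xz) zm.
  have yu : y \in u by rewrite (mem_subseq sw1) // !inE eqxx orbT.
  by have := allP um _ yu; rewrite /= -zm; lia.
case=> <- <- <- _ sw1 _; case/negP: au; apply/contains_132; by exists x, y, z; rewrite xz zy.
Qed.

Lemma size_words132 n w : w \in words132 n -> size w = n.
Proof. by rewrite mem_words132 => /andP [/perm_size ->]; rewrite size_iota. Qed.

Lemma words132_graft n a L R : a <= n -> L \in words132 a -> R \in words132 (n - a) ->
  graft L R \in words132 n.+1.
Proof.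
move=> lean wL wR; have [sL sR] := (size_words132 wL, size_words132 wR).
move: wL wR; rewrite !mem_words132 /graft sL sR subnKC // => /andP [pL avL] /andP [pR avR].
have := graft_peak pL pR; rewrite subnKC // => pk.
rewrite peak_avoids_132 ?andbT //; last by rewrite /avoids contains_shift.
rewrite -cat1s perm_catCA perm_catC -(addn1 n) iotaD add1n addn1 perm_cat //.
rewrite -{2}(subnK lean) iotaD perm_catC perm_cat // addnC iotaDl.
exact: perm_map.
Qed.

(** Classifying by the position [a] of the maximum makes [graft] a bijection onto
    each class. *)
Lemma words132_split n a : a <= n ->
  perm_eq [seq w <- words132 n.+1 | index n.+1 w == a]
          [seq graft L R | L <- words132 a, R <- words132 (n - a)].
Proof.
move=> lean; apply: uniq_perm; first by rewrite filter_uniq ?uniq_words132.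
  apply: allpairs_uniq; rewrite ?uniq_words132 // => [[L R] [L' R']].
  move=> /allpairsP [[? ?] [/= /size_words132 sL /size_words132 sR [-> ->]]].
  move=> /allpairsP [[? ?] [/= /size_words132 sL' /size_words132 sR' [-> ->]]].
  rewrite /graft /= sL sR sL' sR' => /eqP.
  rewrite eqseq_cat ?size_map ?sL ?sL' // eqseq_cons => /and3P [/eqP eL _ /eqP ->].
  by rewrite (inj_map (@addnI _) eL).
move=> w; rewrite mem_filter; apply/andP/allpairsP => [[/eqP ia] | [[L R] [/= wL wR ->]]].
  rewrite mem_words132 => /andP [pw avw].
  have mw : n.+1 \in w by rewrite (perm_mem pw) mem_iota add1n !ltnS leqnn.
  have uw : uniq w by rewrite (perm_uniq pw) iota_uniq.
  have gw : uniq132 w by rewrite /uniq132 uw.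
  have ltw x : x \in w -> x != n.+1 -> x < n.+1.
    by rewrite (perm_mem pw) mem_iota add1n [x < n.+2]ltnS => /andP [_ xn] xn1; rewrite ltn_neqAle xn1.
  case/splitPr: mw ia pw avw uw gw ltw => P R.
  rewrite cat_uniq /= => + + + /and4P [_ /norP [nP _] nR _].
  rewrite index_cat (negbTE nP) /= eqxx addn0 => sP pw avw gw ltw.
  have pk : peak P n.+1 R.
    apply: uniq132_peak gw; apply/allP => x xw /=; apply: ltw.
    - by rewrite mem_cat xw.
    - by apply: contraNneq nP => <-.
    - by rewrite mem_cat inE xw !orbT.
    by apply: contraNneq nR => <-.
  have pPR : perm_eq (P ++ R) (iota 1 n).
    move: pw; rewrite -cat1s perm_catCA perm_sym -[1 :: _]/(iota 1 n.+1) -(addn1 n) iotaD add1n addn1 => pw.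
    by rewrite -(perm_cons n.+1) perm_sym -[_ :: iota 1 n]cat1s perm_catC.
  have sR : size R = n - a.
    by have := perm_size pPR; rewrite size_cat size_iota sP; lia.
  case/and3P: pk => _ _ abv; have [pR pP] := above_perm_iota abv pPR.
  rewrite sR in pR pP; rewrite sP in pP.
  have eP : P = [seq n - a + x | x <- [seq x - (n - a) | x <- P]].
    rewrite -map_comp map_id_in // => x; rewrite (perm_mem pP) mem_iota /= => /andP [ltx _].
    by rewrite subnKC // ltnW.
  exists ([seq x - (n - a) | x <- P], R); split => /=.
  - rewrite mem_words132; apply/andP; split.
      by apply: (perm_map_inj (@addnI (n - a))); rewrite -eP -iotaDl addn1.
    rewrite /avoids -(contains_shift (n - a)) -eP.
    by apply: contra avw; apply: contains_subseq; apply: prefix_subseq.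
  - rewrite mem_words132 pR; apply: contra avw; apply: contains_subseq.
    by rewrite -cat_rcons suffix_subseq.
  by rewrite /graft size_map sP sR subnKC // -eP.
rewrite (words132_graft lean wL wR); split=> //.
have [sL sR] := (size_words132 wL, size_words132 wR).
rewrite /graft sL sR subnKC // index_cat size_map sL /= eqxx addn0 ifN //.
have := words132_graft lean wL wR; rewrite mem_words132 => /andP [/perm_uniq + _].
rewrite iota_uniq /graft sL sR subnKC // cat_uniq /=.
by case/and3P => _ /norP [].
Qed.

(** * Recurrence for the numbers of even and odd permutations *)

Local Open Scope ring_scope.

Lemma sum_words132S (V : nmodType) n (F : seq nat -> V) :
  \sum_(w <- words132 n.+1) F w =
  \sum_(a < n.+1) \sum_(L <- words132 a) \sum_(R <- words132 (n - a)) F (graft L R).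
Proof.
rewrite (partition_big (fun w => inord (index n.+1 w) : 'I_n.+1) predT) //=.
apply: eq_bigr => a _; have lean : (a <= n)%N by rewrite -ltnS.
rewrite big_seq_cond (eq_bigl (fun w => (w \in words132 n.+1) && (index n.+1 w == a))).
  by rewrite -big_seq_cond -big_filter (perm_big _ (words132_split lean)) big_allpairs_dep.
move=> w; apply: andb_id2l => ww; have sw := size_words132 ww.
rewrite -val_eqE /= inordK // -sw index_mem.
by move: ww; rewrite mem_words132 => /andP [/perm_mem -> _]; rewrite mem_iota sw add1n !ltnS leqnn.
Qed.

(** Indexing by the parity lets one statement serve for even and odd
    permutations, and lets parities be added. *)
Definition gf (eps : bool) (t : seq nat) : fps rat := if eps then gfO t else gfE t.

Lemma coefs_gf eps t n : coefs (gf eps t) n =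
  \sum_(w <- words132 n) (avoids w t && (odd (inversions w) == eps))%:R.
Proof.
rewrite big_filter big_map big_enum_cond /= -natr_sum -big_mkcondr /= sum1_card.
case: eps; congr (_%:R); apply: eq_card => s /=;
  by rewrite [RHS]unfold_in inE odd_oneline ?eqb_id // eqbF_neg.
Qed.

(** [p] is decreasing and [s] increasing, so at most one term is nonzero, the one
    with [p d] true and [p d.+1] false; for that [d], the value [s d] decides
    the whole conjunction. *)
Lemma avoid_telescope (R : pzRingType) (p s : nat -> bool) N :
  p 0%N -> (forall d, p d.+1 -> p d) -> (forall d, s d -> s d.+1) ->
  (~~ p N && all (fun d => ~~ (p d && s d)) (iota 0 N))%:R =
  \sum_(d < N) ((~~ p d.+1)%:R - (~~ p d)%:R) * (~~ s d)%:R :> R.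
Proof.
move=> p0 pS sS; elim: N => [|N IHN]; first by rewrite p0 big_ord0.
have -> : iota 0 N.+1 = rcons (iota 0 N) N by rewrite -cats1 -(addn1 N) iotaD.
rewrite all_rcons big_ord_recr /= -IHN [~~ (p N && _) && _]andbC.
case pN: (p N); last first.
  have -> : p N.+1 = false by apply/negP => /pS; rewrite pN.
  by rewrite /= subrr mul0r addr0 andbT.
rewrite /= add0r subr0 -natrM mulnb; case: (boolP (s N)) => [_ | sN]; first by rewrite !andbF.
rewrite /= !andbT; case: (p N.+1) => //=; suff -> : all (fun d => ~~ (p d && s d)) (iota 0 N) by [].
apply/allP => d; rewrite mem_iota add0n => /andP [_ ltdN].
rewrite negb_and orbC; apply/orP; left; apply: contra sN => sd.
by elim: N ltdN {IHN pN} => // N IHN; rewrite ltnS leq_eqVlt => /predU1P [<- | /IHN]; apply: sS.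
Qed.

Lemma gf_std eps t : gf eps (std t) = gf eps t.
Proof.
by apply: fpsP => n; rewrite !coefs_gf; apply: eq_bigr => w _; rewrite /avoids contains_std.
Qed.

Lemma avoids_graft n a L R t : uniq132 t -> t != [::] -> (a <= n)%N ->
  L \in words132 a -> R \in words132 (n - a) ->
  (avoids (graft L R) t)%:R = \sum_(d < size (blocks t))
     ((avoids L (prefix_word (blocks t) d.+1))%:R - (avoids L (prefix_word (blocks t) d))%:R)
     * (avoids R (suffix_word (blocks t) d))%:R :> rat.
Proof.
move=> gt tn0 lean wL wR; have [sL sR] := (size_words132 wL, size_words132 wR).
move: wL wR; rewrite !mem_words132 => /andP [pL _] /andP [pR _].
have pk := graft_peak pL pR; rewrite /graft sL sR.
rewrite /avoids (contains_peak gt tn0 pk) -all_predC -(addn1 (size _)) iotaD all_cat /= add0n andbT.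
rewrite {2}/suffix_word drop_size contains_nil andbT andbC contains_shift.
rewrite -(@avoid_telescope _ (fun d => contains L (prefix_word (blocks t) d))
           (fun d => contains R (suffix_word (blocks t) d))).
- by congr (_ && _)%:R; apply: eq_all => d /=; rewrite contains_shift.
- exact: contains_nil.
- by move=> d; apply: contains_prefixS.
by move=> d; apply: contains_suffixS.
Qed.

(** [graft] creates [(a + 1) * (n - a)] inversions. *)
Lemma odd_inversions_graft n a L R : (a <= n)%N -> L \in words132 a -> R \in words132 (n - a) ->
  odd (inversions (graft L R)) =
  odd (inversions L) (+) odd (inversions R) (+) (~~ odd a && odd (n - a)).
Proof.
move=> lean wL wR; have [sL sR] := (size_words132 wL, size_words132 wR).
move: wL wR; rewrite !mem_words132 => /andP [pL _] /andP [pR _].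
have pk := graft_peak pL pR; rewrite /graft sL sR inversions_peak // inversions_shift size_map sL sR.
by rewrite oddD oddM oddD.
Qed.

(** [dl] is the parity of the left part; that of the right part is then forced,
    and includes the flip of [odd_inversions_graft]. *)
Lemma gf_coefS eps t n : uniq132 t -> t != [::] ->
  coefs (gf eps t) n.+1 = \sum_(d < size (blocks t)) \sum_(a < n.+1) \sum_(dl : bool)
    coefs (gf dl (prefix_word (blocks t) d.+1) - gf dl (prefix_word (blocks t) d)) a *
    coefs (gf (eps (+) dl (+) (~~ odd a && odd (n - a))) (suffix_word (blocks t) d)) (n - a).
Proof.
move=> gt tn0; rewrite coefs_gf sum_words132S [RHS]exchange_big /=.
apply: eq_bigr => a _; have lean : (a <= n)%N by rewrite -ltnS.
under [RHS]eq_bigr => d _ do under eq_bigr => dl _ do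
  rewrite /= !coefs_gf -sumrB big_distrlr /=.
transitivity (\sum_(L <- words132 a) \sum_(R <- words132 (n - a))
   \sum_(d < size (blocks t)) \sum_(dl : bool)
     ((avoids L (prefix_word (blocks t) d.+1) && (odd (inversions L) == dl))%:R
       - (avoids L (prefix_word (blocks t) d) && (odd (inversions L) == dl))%:R) *
     (avoids R (suffix_word (blocks t) d) &&
       (odd (inversions R) == eps (+) dl (+) (~~ odd a && odd (n - a))))%:R : rat); last first.
  under [LHS]eq_bigr => L _ do rewrite exchange_big.
  rewrite [LHS]exchange_big; apply: eq_bigr => d _.
  by under [LHS]eq_bigr => L _ do rewrite exchange_big; rewrite [LHS]exchange_big.
rewrite big_seq [RHS]big_seq; apply: eq_bigr => L wL.
rewrite big_seq [RHS]big_seq; apply: eq_bigr => R wR.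
rewrite -mulnb natrM (avoids_graft gt tn0 lean wL wR) (odd_inversions_graft lean wL wR) mulr_suml.
apply: eq_bigr => d _; rewrite big_bool /= -!mulnb !natrM.
case: (odd (inversions L)); case: (odd (inversions R)); case: eps;
  case: (odd a); case: (odd (n - a)) => /=; ring.
Qed.

(** * Even and odd parts of power series *)

Section FpsTheory.
Variable R : comNzRingType.
Implicit Types F G : fps R.

Lemma coefsD F G n : coefs (F + G) n = coefs F n + coefs G n. Proof. by []. Qed.
Lemma coefsN F n : coefs (- F) n = - coefs F n. Proof. by []. Qed.
Lemma coefsM F G n : coefs (F * G) n = \sum_(i < n.+1) coefs F i * coefs G (n - i).
Proof. by []. Qed.

Lemma coefs_sum I (r : seq I) P (F : I -> fps R) n :
  coefs (\sum_(i <- r | P i) F i) n = \sum_(i <- r | P i) coefs (F i) n.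
Proof. by elim/big_rec2: _ => // i _ ? _ <-. Qed.

Lemma coefs_bool (b : bool) n : coefs (b%:R : fps R) n = (b && (n == 0%N))%:R.
Proof. by case: b => //=; rewrite coef1. Qed.

Lemma poly_fpsM (p q : {poly R}) : poly_fps (p * q) = poly_fps p * poly_fps q.
Proof. by apply: fpsP => n; rewrite coefsM /= coefM. Qed.

Lemma poly_fpsD (p q : {poly R}) : poly_fps (p + q) = poly_fps p + poly_fps q.
Proof. by apply: fpsP => n; rewrite coefsD /= coefD. Qed.

Lemma coefsXM F n : coefs (poly_fps 'X * F) n = if n is m.+1 then coefs F m else 0.
Proof.
rewrite coefsM big_ord_recl /= coefX mul0r add0r.
case: n => [|n]; first by rewrite big_ord0.
rewrite big_ord_recl /= coefX mul1r subSS subn0 big1 ?addr0 // => i _.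
by rewrite coefX mul0r.
Qed.

(** The even part ([c = false]) or the odd part ([c = true]). *)
Definition fps_part (c : bool) F : fps R :=
  Fps (fun n => if odd n == c then coefs F n else 0).

Lemma fps_partB c F G : fps_part c (F - G) = fps_part c F - fps_part c G.
Proof.
by apply: fpsP => n; rewrite !coefsD !coefsN /=; case: ifP => _; rewrite ?subr0.
Qed.

Lemma fps_part_sum F : fps_part false F + fps_part true F = F.
Proof.
by apply: fpsP => n; rewrite coefsD /=; case: (odd n); rewrite ?addr0 ?add0r.
Qed.

Lemma fps_negXE F : fps_negX F = fps_part false F - fps_part true F.
Proof.
apply: fpsP => n; rewrite coefsD coefsN /= -signr_odd.
by case: (odd n); rewrite ?subr0 ?add0r ?mulN1r ?mul1r.
Qed.

Lemma fps_parity F : exists F0 F1, [/\ fps_part false F = F0, fps_part true F = F1,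
  fps_negX F = F0 - F1 & F = F0 + F1].
Proof.
by exists (fps_part false F), (fps_part true F); rewrite fps_negXE fps_part_sum.
Qed.

Lemma fps_negXM F G : fps_negX (F * G) = fps_negX F * fps_negX G.
Proof.
apply: fpsP => n; rewrite [RHS]coefsM /= mulr_sumr; apply: eq_bigr => i _.
by rewrite mulrACA -exprD subnKC // -ltnS.
Qed.

(** Named so as to carry its structure of ring morphism, through which the
    constant coefficient of a determinant is computed. *)
Definition fps_coef0 F : R := coefs F 0.
Fact coef0_zmod_morphism : zmod_morphism fps_coef0.
Proof. by []. Qed.
Fact coef0_monoid_morphism : monoid_morphism fps_coef0.
Proof.
split=> [|F G]; first by rewrite /fps_coef0 /= coef1.
by rewrite /fps_coef0 coefsM big_ord_recl big_ord0 addr0.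
Qed.
HB.instance Definition _ :=
  GRing.isZmodMorphism.Build (fps R) R fps_coef0 coef0_zmod_morphism.
HB.instance Definition _ :=
  GRing.isMonoidMorphism.Build (fps R) R fps_coef0 coef0_monoid_morphism.

(** The lowest coefficient of [F] would survive in [D * F]. *)
Lemma fps_regular D F : coefs D 0 = 1 -> D * F = 0 -> F = 0.
Proof.
move=> D0 DF; apply: fpsP => n; have [m] := ubnP n; elim: m n => // m IHm n.
rewrite ltnS => lenm; have := congr1 (fun G => coefs G n) DF.
rewrite coefsM big_ord_recl D0 mul1r subn0 big1 ?addr0 // => i _.
rewrite IHm ?mulr0 //; apply: leq_trans lenm; rewrite /= /bump /=.
by have := ltn_ord i; lia.
Qed.

End FpsTheory.

(** * Recurrence between even and odd parts *)

Lemma gf_pi_prefix eps b j : gf eps (pi_prefix b j) = gf eps (prefix_word b j).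
Proof. by rewrite pi_prefixE gf_std. Qed.

Lemma words132_0 : words132 0 = [:: [::]].
Proof.
apply: perm_small_eq => //; apply: uniq_perm; rewrite ?uniq_words132 // => w.
rewrite mem_words132 inE; apply/andP/eqP => [[/perm_size] | ->]; first by case: w.
by split=> //; apply/negP => /contains_132 [? [? [? []]]].
Qed.

Lemma avoids_nil t : avoids [::] t = (t != [::]).
Proof.
congr (~~ _); apply/idP/eqP => [/containsP [u] | ->]; last exact: contains_nil.
by rewrite subseq0 => /eqP -> /order_iso_size; case: t.
Qed.

Lemma gf_coef0 eps t : t != [::] -> coefs (gf eps t) 0 = (~~ eps)%:R.
Proof.
by move=> tn0; rewrite coefs_gf words132_0 big_seq1 avoids_nil tn0; case: eps.
Qed.

Lemma gf_nil eps : gf eps [::] = 0.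
Proof.
by apply: fpsP => n; rewrite coefs_gf big1 // => w _; rewrite /avoids contains_nil.
Qed.

(** The flip in [gf_coefS] depends only on the parities of the two sizes [a] and
    [n - a], so it becomes constant on each product of an even or odd part by
    an even or odd part.  In degree [n + 1] of parity [c], the sizes add up to [n],
    so the parity of [n - a] is [~~ c] plus that of [a]. *)
Lemma gf_part_rec c eps t : uniq132 t -> t != [::] ->
  fps_part c (gf eps t) = (~~ eps && ~~ c)%:R + poly_fps 'X *
    \sum_(d < size (blocks t)) \sum_(dl : bool) \sum_(ca : bool)
       fps_part ca (gf dl (prefix_word (blocks t) d.+1) - gf dl (prefix_word (blocks t) d))
       * fps_part (~~ c (+) ca)
           (gf (eps (+) dl (+) (~~ ca && (~~ c (+) ca))) (suffix_word (blocks t) d)).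
Proof.
move=> gt tn0; apply: fpsP => n; rewrite coefsD coefs_bool coefsXM.
case: n => [|n]; first by rewrite /= gf_coef0 // eqxx andbT addr0; case: c; rewrite ?andbF ?andbT.
rewrite [coefs (fps_part _ _) _]/= andbF add0r (gf_coefS _ _ gt tn0) coefs_sum.
rewrite -[LHS]/(if odd n.+1 == c then _ else _).
transitivity (\sum_(d < size (blocks t)) if odd n.+1 == c then \sum_(a < n.+1) \sum_(dl : bool)
    coefs (gf dl (prefix_word (blocks t) d.+1) - gf dl (prefix_word (blocks t) d)) a *
    coefs (gf (eps (+) dl (+) (~~ odd a && odd (n - a))) (suffix_word (blocks t) d)) (n - a)
    else 0).
  by case: ifP => // _; rewrite big1.
apply: eq_bigr => d _; rewrite coefs_sum.
under [RHS]eq_bigr => dl _.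
  rewrite coefs_sum; under eq_bigr => ca _ do rewrite coefsM.
  rewrite exchange_big; over.
rewrite [RHS]exchange_big /=.
transitivity (\sum_(a < n.+1) \sum_(dl : bool) if ~~ odd n == c then
    coefs (gf dl (prefix_word (blocks t) d.+1) - gf dl (prefix_word (blocks t) d)) a *
    coefs (gf (eps (+) dl (+) (~~ odd a && odd (n - a))) (suffix_word (blocks t) d)) (n - a)
    else 0).
  by case: ifP => // _; rewrite big1 // => a _; rewrite big1.
apply: eq_bigr => a _; apply: eq_bigr => dl _.
have lean : (a <= n)%N by rewrite -ltnS.
rewrite big_bool /= oddB //.
by case: c; case: (odd n); case: (odd a); rewrite /= ?mulr0 ?mul0r ?addr0 ?add0r.
Qed.

(** * Rational power series and linear systems *)

Lemma rational_poly (p : {poly rat}) : fps_rational (poly_fps p).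
Proof. by exists p, 1; rewrite oner_neq0 mul1r. Qed.

Lemma rational_bool (b : bool) : fps_rational (b%:R : fps rat).
Proof.
case: b; first exact: (rational_poly 1).
suff -> : (false%:R : fps rat) = poly_fps 0 by exact: rational_poly.
by apply: fpsP => n; rewrite coefs_bool /= coef0.
Qed.

Lemma rationalD (F G : fps rat) : fps_rational F -> fps_rational G -> fps_rational (F + G).
Proof.
move=> [p [q [q0 eF]]] [p' [q' [q'0 eG]]]; exists (q' * p + q * p'), (q * q').
by rewrite mulf_neq0 // poly_fpsD !poly_fpsM -eF -eG; split => //; ring.
Qed.

Lemma rationalM (F G : fps rat) : fps_rational F -> fps_rational G -> fps_rational (F * G).
Proof.
move=> [p [q [q0 eF]]] [p' [q' [q'0 eG]]]; exists (p * p'), (q * q').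
by rewrite mulf_neq0 // !poly_fpsM -eF -eG; split => //; ring.
Qed.

Lemma rationalN (F : fps rat) : fps_rational F -> fps_rational (- F).
Proof.
move=> rF; rewrite -mulN1r; apply: rationalM rF.
suff -> : -1 = poly_fps (-1) :> fps rat by exact: rational_poly.
by apply: fpsP => n; rewrite coefsN /= coefN.
Qed.

Lemma rationalB (F G : fps rat) : fps_rational F -> fps_rational G -> fps_rational (F - G).
Proof. by move=> rF rG; apply: rationalD => //; apply: rationalN. Qed.

Lemma rational_sum I (r : seq I) (P : pred I) (f : I -> fps rat) :
  (forall i, P i -> fps_rational (f i)) -> fps_rational (\sum_(i <- r | P i) f i).
Proof.
by move=> rf; elim/big_rec: _ => [|i x Pi rx]; [exact: (rational_bool false) | apply: rationalD; auto].
Qed.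

Lemma rational_prod I (r : seq I) (P : pred I) (f : I -> fps rat) :
  (forall i, P i -> fps_rational (f i)) -> fps_rational (\prod_(i <- r | P i) f i).
Proof.
by move=> rf; elim/big_rec: _ => [|i x Pi rx]; [exact: (rational_bool true) | apply: rationalM; auto].
Qed.

Lemma negX_poly (p : {poly rat}) :
  fps_negX (poly_fps p) = poly_fps (\poly_(i < size p) ((-1) ^+ i * p`_i)).
Proof.
apply: fpsP => n; rewrite /= coef_poly; case: ltnP => // le.
by rewrite nth_default // mulr0.
Qed.

Lemma rational_negX (F : fps rat) : fps_rational F -> fps_rational (fps_negX F).
Proof.
move=> [p [q [q0 eF]]]; exists (\poly_(i < size p) ((-1) ^+ i * p`_i)).
exists (\poly_(i < size q) ((-1) ^+ i * q`_i)).
rewrite -!negX_poly -eF fps_negXM; split=> //; apply: contra q0 => /eqP q0.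
apply/eqP/polyP => n; apply/eqP; rewrite coef0.
have := congr1 (fun r => coefs (poly_fps r) n) q0; rewrite -negX_poly /= coef0 => /eqP.
by rewrite mulf_eq0 signr_eq0.
Qed.

Definition fps_half : fps rat := poly_fps (2^-1)%:P.
Lemma fps_half2 : fps_half + fps_half = 1.
Proof.
apply: fpsP => n; rewrite coefsD /= coef1 coefC; case: n => [|n] /=; last by rewrite addr0.
by apply/eqP.
Qed.

(** The parts of [F] are [(F(x) + F(-x)) / 2] and [(F(x) - F(-x)) / 2]. *)
Lemma rational_part c (F : fps rat) : fps_rational F -> fps_rational (fps_part c F).
Proof.
move=> rF; have rN := rational_negX rF; have rh := rational_poly (2^-1)%:P.
have [F0 [F1 [<- <- en eF]]] := fps_parity F.
have {en eF} [e0 e1] : fps_part false F = fps_half * (F + fps_negX F) /\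
                       fps_part true F = fps_half * (F - fps_negX F).
  have [F0' [F1' [-> -> -> ->]]] := fps_parity F.
  by split; rewrite -[LHS]mul1r -fps_half2; ring.
case: c; rewrite ?e0 ?e1; apply: rationalM => //; first exact: rationalB.
exact: rationalD.
Qed.

(** Division by [D] costs a denominator [p], the numerator of [D], which is nonzero
    as [D] has constant coefficient 1. *)
Lemma rational_div D (F : fps rat) : coefs D 0 = 1 -> fps_rational D -> fps_rational (D * F) ->
  fps_rational F.
Proof.
move=> D0 [p [q [q0 eD]]] [p' [q' [q'0 eDF]]].
exists (q * p'), (q' * p); split; last first.
  by rewrite !poly_fpsM -eD -eDF; ring.
rewrite mulf_neq0 //; apply: contra q0 => /eqP p0.
have : poly_fps q = 0.
  apply: (fps_regular D0); rewrite mulrC eD p0.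
  by apply: fpsP => n /=; rewrite coef0.
by move=> eq0; apply/eqP/polyP => n; have := congr1 (fun G => coefs G n) eq0; rewrite coef0.
Qed.

Lemma rational_det n (M : 'M[fps rat]_n) :
  (forall i j, fps_rational (M i j)) -> fps_rational (\det M).
Proof.
move=> rM; apply: rational_sum => s _; apply: rationalM.
  by rewrite -signr_odd; case: (odd _); [apply: rationalN|]; apply: (rational_bool true).
by apply: rational_prod.
Qed.

(** Cramer's rule: the determinant of [1 - x M] has constant coefficient 1 since
    the matrix is the identity modulo [x]. *)
Lemma rational_system (I : finType) (v c : I -> fps rat) (M : I -> I -> fps rat) :
  (forall i, fps_rational (c i)) -> (forall i j, fps_rational (M i j)) ->
  (forall i, v i = c i + poly_fps 'X * \sum_j M i j * v j) ->
  forall i, fps_rational (v i).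
Proof.
move=> rc rM ev i0.
pose X : fps rat := poly_fps 'X.
pose V := \col_(i < #|I|) v (enum_val i); pose C := \col_(i < #|I|) c (enum_val i).
pose N := \matrix_(i < #|I|, j < #|I|) (X * M (enum_val i) (enum_val j)).
pose D := 1%:M - N.
have rN i j : fps_rational (N i j) by rewrite mxE; apply: rationalM; first exact: rational_poly.
have rD i j : fps_rational (D i j).
  rewrite !mxE; apply: rationalB; last by have := rN i j; rewrite mxE.
  exact: rational_bool.
have DV : D *m V = C.
  apply/matrixP => i j; rewrite mulmxBl mul1mx !mxE ev.
  rewrite (reindex (@enum_val I I)) /=; last exact/onW_bij/enum_val_bij.
  rewrite -addrA mulr_sumr -sumrB big1 ?addr0 // => k _.
  by rewrite !mxE mulrA subrr.
have detD : coefs (\det D) 0 = 1.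
  rewrite -[LHS]/(fps_coef0 (\det D)) -det_map_mx; apply: etrans (det1 _ #|I|).
  congr (\det _); apply/matrixP => i j; rewrite !mxE rmorphB rmorphM rmorph_nat.
  have X0 : fps_coef0 X = 0 by rewrite /fps_coef0 /= coefX.
  by rewrite -[LHS]/((i == j)%:R - fps_coef0 X * _) X0 mul0r subr0.
have adjDV : \det D *: V = \adj D *m C.
  by rewrite -DV mulmxA mul_adj_mx mul_scalar_mx.
suff : fps_rational (\det D * v i0).
  exact: rational_div detD (rational_det rD).
have -> : \det D * v i0 = (\adj D *m C) (enum_rank i0) 0.
  by rewrite -adjDV !mxE enum_rankK.
rewrite mxE; apply: rational_sum => k _; apply: rationalM; last by rewrite mxE.
rewrite mxE /cofactor; apply: rationalM.
  by rewrite -signr_odd; case: (odd _); [apply: rationalN|]; apply: (rational_bool true).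
by apply: rational_det => i j; rewrite 2!mxE.
Qed.

(** Inhomogeneous linear forms in the unknowns [v] with rational coefficients. *)
Definition affine (I : finType) (v : I -> fps rat) (F : fps rat) : Prop :=
  exists c (M : I -> fps rat), [/\ fps_rational c, forall j, fps_rational (M j)
    & F = c + \sum_j M j * v j].

Section Affine.
Variables (I : finType) (v : I -> fps rat).

Lemma affine_rational (F : fps rat) : fps_rational F -> affine v F.
Proof.
move=> rF; exists F, (fun=> 0); split=> // [j|]; first exact: (rational_bool false).
by rewrite big1 ?addr0 // => j _; rewrite mul0r.
Qed.

Lemma affine_var i : affine v (v i).
Proof.
exists 0, (fun j => (j == i)%:R); split=> [|j|]; try exact: rational_bool.
  exact: (rational_bool false).
rewrite add0r (bigD1 i) //= eqxx mul1r big1 ?addr0 // => j /negbTE ->.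
by rewrite mul0r.
Qed.

Lemma affineD (F G : fps rat) : affine v F -> affine v G -> affine v (F + G).
Proof.
move=> [c [M [rc rM ->]]] [c' [M' [rc' rM' ->]]].
exists (c + c'), (fun j => M j + M' j); split=> [|j|]; try exact: rationalD.
rewrite addrACA -big_split; congr (_ + _); apply: eq_bigr => j _.
by rewrite mulrDl.
Qed.

Lemma affineMl (F G : fps rat) : fps_rational F -> affine v G -> affine v (F * G).
Proof.
move=> rF [c [M [rc rM ->]]]; exists (F * c), (fun j => F * M j).
split=> [|j|]; try exact: rationalM.
by rewrite mulrDr mulr_sumr; congr (_ + _); apply: eq_bigr => j _; rewrite mulrA.
Qed.

Lemma affineB (F G : fps rat) : affine v F -> affine v G -> affine v (F - G).
Proof.
move=> aF aG; apply: affineD aF _; rewrite -mulN1r.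
by apply: affineMl aG; apply: rationalN; apply: (rational_bool true).
Qed.

Lemma affine_sum J (r : seq J) (P : pred J) (f : J -> fps rat) :
  (forall i, P i -> affine v (f i)) -> affine v (\sum_(i <- r | P i) f i).
Proof.
move=> af; elim/big_rec: _ => [|i x Pi ax]; last by apply: affineD; auto.
exact/affine_rational/(rational_bool false).
Qed.

Lemma affine_system (c : I -> fps rat) (S : I -> fps rat) :
  (forall i, fps_rational (c i)) -> (forall i, affine v (S i)) ->
  (forall i, v i = c i + poly_fps 'X * S i) -> forall i, fps_rational (v i).
Proof.
move=> rc aS ev.
have [cM cMP] := choice aS.
have [M MP] := choice cMP.
apply: (@rational_system I v (fun i => c i + poly_fps 'X * cM i) M).
- move=> i; have [rcM _ _] := MP i; apply: rationalD => //.
  by apply: rationalM => //; apply: rational_poly.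
- by move=> i j; have [_ + _] := MP i.
by move=> i; have [_ _ eS] := MP i; rewrite ev eS; ring.
Qed.

End Affine.

(** * Rationality and the four identities *)

Lemma size_unblocks_gt0 b : b != [::] -> (0 < size (unblocks b))%N.
Proof. by case: b => // [[t x] b] _; rewrite unblocks_cons size_cat /= addnS. Qed.

Lemma blocks_nil t : (blocks t == [::]) = (t == [::]).
Proof. by apply/eqP/eqP => [e | -> //]; rewrite -[t]blocksK e. Qed.

Lemma prefix_subword t j : subseq (prefix_word (blocks t) j) t.
Proof.
case: j => [|[|j]]; first exact: sub0seq.
  rewrite -{2}[t]blocksK /prefix_word; case: (blocks t) => [|[t1 x] b]; first exact: sub0seq.
  by rewrite unblocks_cons prefix_subseq.
by rewrite -{2}(take_drop_blocks j.+2 t) prefix_subseq.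
Qed.

Lemma suffix_subword t d : subseq (suffix_word (blocks t) d) t.
Proof. by rewrite -{2}(take_drop_blocks d t) suffix_subseq. Qed.

Lemma size_prefix_word t j : t != [::] ->
  (j < size (blocks t))%N || (j <= 1)%N -> (size (prefix_word (blocks t) j) < size t)%N.
Proof.
move=> tn0; case: j => [|[|j]]; first by move=> _; rewrite lt0n size_eq0.
  move=> _; have := tn0; rewrite -blocks_nil -{3}[t]blocksK /prefix_word.
  by case: (blocks t) => // [[t1 x] b] _; rewrite unblocks_cons size_cat /= addnS ltnS leq_addr.
rewrite orbF /prefix_word => ltj; rewrite -{2}(take_drop_blocks j.+2 t) size_cat.
by rewrite -addn1 leq_add2l size_unblocks_gt0 // -size_eq0 size_drop -lt0n subn_gt0.
Qed.

Lemma size_suffix_word t d : t != [::] -> (0 < d)%N ->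
  (size (suffix_word (blocks t) d) < size t)%N.
Proof.
move=> tn0 d0; rewrite -{2}(take_drop_blocks d t) size_cat -add1n leq_add2r.
rewrite size_unblocks_gt0 // -size_eq0 size_take_min.
move: tn0; rewrite -blocks_nil -size_eq0; lia.
Qed.

(** The unknowns are the even and odd parts of both generating functions of [t].
    Among the patterns in the [d]-th term of [gf_part_rec], only
    [suffix_word _ 0], and [prefix_word _ d.+1] for the last [d > 0], can be [t]
    itself, so that every product has a rational factor. *)
Lemma gf_rational eps t : uniq132 t -> fps_rational (gf eps t).
Proof.
have [n] := ubnP (size t); elim: n t eps => // n IHn t eps.
rewrite ltnS => szt gt; case: (altP (t =P [::])) => [-> | tn0].
  by rewrite gf_nil; apply: (rational_bool false).
have smaller s e : subseq s t -> (size s < size t)%N -> fps_rational (gf e s).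
  by move=> st lt; apply: IHn; [exact: leq_trans lt szt | exact: uniq132_subseq st gt].
pose v (i : bool * bool) := fps_part i.1 (gf i.2 t).
have aff c e s : subseq s t -> (size s < size t)%N || (s == t) ->
    affine v (fps_part c (gf e s)).
  move=> st /orP [lt | /eqP ->]; last exact: (affine_var v (c, e)).
  exact/affine_rational/rational_part/smaller.
suff rv i : fps_rational (v i).
  by rewrite -(fps_part_sum (gf eps t)); apply: rationalD; apply: (rv (_, _)).
move: i; apply: affine_system (fun i => gf_part_rec i.1 i.2 gt tn0) => [i | i].
  exact: rational_bool.
apply: affine_sum => d _; apply: affine_sum => dl _; apply: affine_sum => ca _.
have [d0 | dgt0] := posnP d; last first.
  rewrite mulrC; apply: affineMl.
    apply: rational_part; apply: smaller (suffix_subword _ _) _.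
    exact: size_suffix_word.
  rewrite fps_partB; apply: affineB; apply: aff (prefix_subword _ _) _; last first.
    by rewrite size_prefix_word // ltn_ord.
  have [lt | ge] := ltnP d.+1 (size (blocks t)); first by rewrite size_prefix_word // lt.
  have {}ge : size (blocks t) = d.+1 by have := ltn_ord d; lia.
  apply/orP; right; case: (nat_of_ord d) dgt0 ge => // k _ ge.
  by rewrite /prefix_word -ge take_size blocksK.
rewrite d0; apply: affineMl.
  by apply: rational_part; apply: rationalB; apply: smaller (prefix_subword _ _) _;
    apply: size_prefix_word => //; rewrite orbT.
by apply: aff (suffix_subword _ _) _; rewrite /suffix_word drop0 blocksK eqxx orbT.
Qed.

Lemma uniq132_oneline k (tau : 'S_k) : avoids (oneline tau) [:: 1; 3; 2]%N -> uniq132 (oneline tau).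
Proof. by move=> av; rewrite /uniq132 uniq_oneline. Qed.

Lemma poly_fps_half : poly_fps (2^-1 *: 'X : {poly rat}) = fps_half * poly_fps 'X.
Proof. by rewrite -poly_fpsM mul_polyC. Qed.

(** Every series below is its even part plus its odd part, and [F(-x)] is their
    difference; in terms of these parts both sides are polynomials. *)
Ltac ring_in_parts A B E O :=
  case: (fps_parity A) => [? [? [-> -> -> ->]]];
  case: (fps_parity B) => [? [? [-> -> -> ->]]];
  case: (fps_parity E) => [? [? [-> -> -> ->]]];
  case: (fps_parity O) => [? [? [-> -> -> ->]]];
  ring.

Unset Implicit Arguments.

Theorem theorem2p4 (k : nat) (tau : 'S_k) (hk : (1 <= k)%N)
    (htau : avoids (oneline tau) [:: 1; 3; 2]%N) :
  let t := oneline tau in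
  let b := blocks t in
  let r := (size b).-1 in
  let sg d := sigma_suffix b d in
  let A d := gfE (pi_prefix b d.+1) - gfE (pi_prefix b d) in
  let B d := gfO (pi_prefix b d.+1) - gfO (pi_prefix b d) in
  let neg := @fps_negX rat in
  let x := poly_fps ('X : {poly rat}) in
  let x_half := poly_fps (2^-1 *: 'X : {poly rat}) in
  [/\ fps_rational (gfE t) /\ fps_rational (gfO t),
      gfE t - neg (gfE t) =
        x * \sum_(0 <= d < r.+1)
          (A d * gfE (sg d) + neg (A d) * neg (gfE (sg d))
           + B d * gfO (sg d) + neg (B d) * neg (gfO (sg d))),
      gfO t - neg (gfO t) =
        x * \sum_(0 <= d < r.+1)
          (A d * gfO (sg d) + neg (A d) * neg (gfO (sg d))
           + B d * gfE (sg d) + neg (B d) * neg (gfE (sg d))),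
      gfE t + neg (gfE t) - 2 =
        x_half * \sum_(0 <= d < r.+1)
          ((A d + neg (A d)) * (gfO (sg d) - neg (gfO (sg d)))
           + (B d + neg (B d)) * (gfE (sg d) - neg (gfE (sg d)))
           + (A d - neg (A d)) * (gfE (sg d) + neg (gfE (sg d)))
           + (B d - neg (B d)) * (gfO (sg d) + neg (gfO (sg d)))) &
      gfO t + neg (gfO t) =
        x_half * \sum_(0 <= d < r.+1)
          ((A d + neg (A d)) * (gfE (sg d) - neg (gfE (sg d)))
           + (B d + neg (B d)) * (gfO (sg d) - neg (gfO (sg d)))
           + (A d - neg (A d)) * (gfO (sg d) + neg (gfO (sg d)))
           + (B d - neg (B d)) * (gfE (sg d) + neg (gfE (sg d))))].
Proof.
move=> t b r sg A B neg x x_half.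
have gt : uniq132 t by exact: uniq132_oneline.
have tn0 : t != [::] by rewrite -size_eq0 size_oneline -lt0n.
have er : r.+1 = size b by rewrite prednK // lt0n size_eq0 blocks_nil.
have rec c eps : fps_part c (gf eps t) = (~~ eps && ~~ c)%:R + x *
    \sum_(0 <= d < r.+1) \sum_(dl : bool) \sum_(ca : bool)
       fps_part ca ((if dl then B else A) d)
       * fps_part (~~ c (+) ca) (gf (eps (+) dl (+) (~~ ca && (~~ c (+) ca))) (sg d)).
  rewrite (gf_part_rec c eps gt tn0) er big_mkord; congr (_ + x * _).
  apply: eq_bigr => d _; apply: eq_bigr => dl _; apply: eq_bigr => ca _.
  by rewrite [sg d]/(std _) gf_std -!gf_pi_prefix; case: dl.
(* [G(x) - G(-x)] and [G(x) + G(-x)] extract the odd and the even part. *)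
have subN G : G - neg G = fps_part true G + fps_part true G.
  by rewrite /neg fps_negXE -{1}[G]fps_part_sum; ring.
have addN G : G + neg G = fps_part false G + fps_part false G.
  by rewrite /neg fps_negXE -{1}[G]fps_part_sum; ring.
have x2 : x_half + x_half = x by rewrite /x_half poly_fps_half -mulrDl fps_half2 mul1r.
split.
- by split; [apply: (gf_rational false) | apply: (gf_rational true)].
- rewrite subN -[gfE t]/(gf false t) rec add0r -mulrDr -big_split; congr (_ * _).
  apply: eq_bigr => d _; rewrite !big_bool /= /neg.
  ring_in_parts (A d) (B d) (gfE (sg d)) (gfO (sg d)).
- rewrite subN -[gfO t]/(gf true t) rec add0r -mulrDr -big_split; congr (_ * _).
  apply: eq_bigr => d _; rewrite !big_bool /= /neg.
  ring_in_parts (A d) (B d) (gfE (sg d)) (gfO (sg d)).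
- rewrite addN -[gfE t]/(gf false t) rec -x2.
  (* Twice a part, and x as twice x/2, make the factor 4 that the products of
     sums and differences carry on the other side. *)
  set S := (X in (x_half + _) * X).
  rewrite (_ : _ - 2 = x_half * (S + S + S + S)); last by rewrite /=; ring.
  rewrite -!big_split; congr (_ * _).
  apply: eq_bigr => d _; rewrite !big_bool /= /neg.
  ring_in_parts (A d) (B d) (gfE (sg d)) (gfO (sg d)).
rewrite addN -[gfO t]/(gf true t) rec -x2.
set S := (X in (x_half + _) * X).
rewrite (_ : _ + _ = x_half * (S + S + S + S)); last by rewrite /=; ring.
rewrite -!big_split; congr (_ * _).
apply: eq_bigr => d _; rewrite !big_bool /= /neg.
ring_in_parts (A d) (B d) (gfE (sg d)) (gfO (sg d)).
Qed.
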